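(* Let $\lambda_{hj},\gamma_{kl},\pi_h,\omega_{ki}$ be the entries on the main diagonals of $\Lambda,\Gamma,\Pi,\Omega$, respectively. Under the setting and assumptions of the context, the following hold. 1. For fixed $h,j\in I_1$: if $\frac{T}{N}\sigma^2-\|\hat g_{LS}^{[hk,jl]}\|^2_{P^{-1}}\ge 0$ for all $k,l\in I_2$, then the subset $\Xi_1=\{(\Lambda,\Gamma,\Pi,\Omega)\in\Xi:\ \lambda_{hj}=0\}$ contains a local minimum for $\ell$. 2. For fixed $k,l\in I_2$: if $\frac{T}{N}\sigma^2-\|\hat g_{LS}^{[hk,jl]}\|^2_{P^{-1}}\ge 0$ for all $h,j\in I_1$, then the subset $\Xi_2=\{(\Lambda,\Gamma,\Pi,\Omega)\in\Xi:\ \gamma_{kl}=0\}$ contains a local minimum for $\ell$. 3. For fixed $h\in I_1$: if $\frac{T}{N}\sigma^2-\|\hat f_{LS}^{[hk,i]}\|^2_{R^{-1}}\ge 0$ for all $k\in I_2$, $i\in I_u$, then the subset $\Xi_3=\{(\Lambda,\Gamma,\Pi,\Omega)\in\Xi:\ \pi_{h}=0\}$ contains a local minimum for $\ell$. 4. For fixed $k\in I_2$, $i\in I_u$: if $\frac{T}{N}\sigma^2-\|\hat f_{LS}^{[hk,i]}\|^2_{R^{-1}}\ge 0$ for all $h\in I_1$, then the subset $\Xi_4=\{(\Lambda,\Gamma,\Pi,\Omega)\in\Xi:\ \omega_{ki}=0\}$ contains a local minimum for $\ell$.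
   Context: Let $p_1,p_2,m,N,T\ge1$ be integers with $N\ge T$; $I_1=\{1,\ldots,p_1\}$, $I_2=\{1,\ldots,p_2\}$, $I_u=\{1,\ldots,m\}$. Data: real scalar sequences $y_{hk}(t)$ ($h\in I_1,k\in I_2$) and $u_i(t)$ ($i\in I_u$), $t=0,\ldots,N$, set to zero for negative times (zero initial conditions). Data vectors and regressors: $\mathrm y^+_{hk}=[\,y_{hk}(N),\ldots,y_{hk}(1)\,]^\top\in\mathbb R^N$, and $\mathrm y^+\in\mathbb R^{p_1p_2N}$ stacks the $\mathrm y^+_{hk}$ in lexicographic order of $(h,k)$. $\phi_{hk},\psi_i\in\mathbb R^{N\times T}$ are the Toeplitz matrices $[\phi_{hk}]_{sn}=y_{hk}(N-s-n+1)$, $[\psi_i]_{sn}=u_i(N-s-n+1)$, $s=1,\ldots,N$, $n=1,\ldots,T$. Put $$\Phi=I_{p_1p_2}\otimes[\,\phi_{11}\ \cdots\ \phi_{1p_2}\ \cdots\ \phi_{p_11}\ \cdots\ \phi_{p_1p_2}\,],\qquad \Psi=I_{p_1p_2}\otimes[\,\psi_1\ \cdots\ \psi_m\,].$$ These correspond to the finite impulse response (length $T$) linear regression $\mathrm y^+=\Phi\theta_g+\Psi\theta_f+\mathrm e^+$, where $\theta_g$ stacks the impulse responses $g^{[hk,jl]}\in\mathbb R^T$ (from node $(j,l)$ to node $(h,k)$) in lexicographic order of $(h,k,j,l)$, $\theta_f$ stacks $f^{[hk,i]}\in\mathbb R^T$ (from input $i$ to node $(h,k)$) in lexicographic order of $(h,k,i)$,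 and all noise components have the same variance $\sigma^2>0$. Kernels: $P,R\in\mathbb R^{T\times T}$ are fixed symmetric positive definite matrices; $\sigma^2$ is fixed. The hyperparameters are $\xi=(\Lambda,\Gamma,\Pi,\Omega)$, where $\Lambda,\Gamma,\Pi,\Omega$ are diagonal matrices of sizes $p_1^2,p_2^2,p_1,p_2m$ with diagonal entries $\lambda_{hj}$ ($h,j\in I_1$), $\gamma_{kl}$ ($k,l\in I_2$), $\pi_h$ ($h\in I_1$), $\omega_{ki}$ ($k\in I_2,i\in I_u$), respectively, ranging over the compact set $$\Xi=\{(\Lambda,\Gamma,\Pi,\Omega):\ 0\le\Lambda,\Gamma,\Pi,\Omega\le\kappa I\},$$ with $\kappa>0$ a sufficiently large constant. $K_g$ is the block diagonal matrix whose diagonal block associated with $g^{[hk,jl]}$ is $\frac{\lambda_{hj}\gamma_{kl}}{\lambda_{hj}+\gamma_{kl}}P$ and $K_f$ is the block diagonal matrix whose diagonal block associated with $f^{[hk,i]}$ is $\frac{\pi_h\omega_{ki}}{\pi_h+\omega_{ki}}R$; these ratios are defined as $0$ whenever one (or both) of the two hyperparameters involved is zero. The negative log-marginal likelihood (up to constants) is $$\ell(\mathrm y^+,\xi)=\log\det V+\tfrac12(\mathrm y^+)^\top V^{-1}\mathrm y^+,\qquad V=\Phi K_g\Phi^\top+\Psi K_f\Psi^\top+\sigma^2I.$$ ''Local minimum for $\ell$'' means a local minimizer of $\xi\mapsto\ell(\mathrm y^+,\xi)$ on $\Xi$. Assumption on the regressors: $$(I\otimes P^{1/2})\Phi^\top\Phi(I\otimes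 P^{1/2})=NI,\quad (I\otimes P^{1/2})\Phi^\top\Psi(I\otimes R^{1/2})=0,\quad (I\otimes R^{1/2})\Psi^\top\Psi(I\otimes R^{1/2})=NI.$$ Least squares estimates: $\hat\theta_{g,LS}=(\Phi^\top\Phi)^{-1}\Phi^\top\mathrm y^+$, $\hat\theta_{f,LS}=(\Psi^\top\Psi)^{-1}\Psi^\top\mathrm y^+$, whose blocks are, under the assumption above, $$\hat g_{LS}^{[hk,jl]}=\tfrac1N P\phi_{jl}^\top\mathrm y^+_{hk},\qquad \hat f_{LS}^{[hk,i]}=\tfrac1N R\psi_i^\top\mathrm y^+_{hk}.$$ For a vector $v$ and positive definite $Q$, $\|v\|^2_{Q^{-1}}=v^\top Q^{-1}v$. *)

(* Defs.v *)
(* MathComp / MathComp-Analysis. *)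
From HB Require Import structures.
From mathcomp Require Import all_boot all_order all_algebra.
From mathcomp Require Import all_classical all_reals all_analysis.
From mathcomp Require Import mxtens.
Set Implicit Arguments.
Unset Strict Implicit.
Unset Printing Implicit Defensive.
Import Order.TTheory GRing.Theory Num.Theory.
Import numFieldNormedType.Exports.
Local Open Scope classical_set_scope.
Local Open Scope ring_scope.

Definition local_min_on (R : realType) (X : topologicalType)
    (f : X -> R) (A : set X) (x : X) : Prop :=
  A x /\ \forall z \near within A (nbhs x), f x <= f z.

Definition posdefmx (R : realType) (n : nat) (Q : 'M[R]_n) : Prop :=
  Q^T = Q /\ forall v : 'cV[R]_n, v != 0 -> 0 < (v^T *m Q *m v) 0 0.

(* The principal square root Q^{1/2}: the unique positive definite S with
   S *m S = Q (meaningful for positive definite Q). *)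
Definition sqrtmx (R : realType) (n : nat) (Q : 'M[R]_n) : 'M[R]_n :=
  xget 0 [set S : 'M[R]_n | posdefmx S /\ S *m S = Q].

(* ||v||^2_{Q^-1} *)
Definition sqnorm_inv (R : realType) (n : nat) (Q : 'M[R]_n) (v : 'cV[R]_n) : R :=
  (v^T *m invmx Q *m v) 0 0.

(* All indices below start at 0. The entry of a stacked vector with (nested)
   lexicographic index (a, b) sits at [mxtens_index (a, b)], whose value is
   a * n + b; this is also the convention of the Kronecker product [*t]. *)

(* Zero initial conditions: extension of a sequence by 0 to negative times. *)
Definition zext (R : realType) (x : nat -> R) (t : int) : R :=
  if t is Posz n then x n else 0.

Definition toeplitz (R : realType) (N T : nat) (x : nat -> R) : 'M[R]_(N, T) :=
  \matrix_(s < N, n < T) zext x (N%:Z - s.+1%:Z - n.+1%:Z + 1).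

(* y^+ *)
Definition yplus (R : realType) (p1 p2 N : nat)
    (y : 'I_p1 -> 'I_p2 -> nat -> R) : 'cV[R]_(p1 * p2 * N) :=
  \col_a (let: (hk, s) := mxtens_unindex a in
          let: (h, k) := mxtens_unindex hk in y h k (N - s)%N).

(* Phi = I (x) [phi_11 ... phi_{p1 p2}] *)
Definition Phi (R : realType) (p1 p2 N T : nat)
    (y : 'I_p1 -> 'I_p2 -> nat -> R) :
    'M[R]_(p1 * p2 * N, p1 * p2 * (p1 * p2 * T)) :=
  1%:M *t (\matrix_(s < N, b < p1 * p2 * T)
     (let: (jl, n) := mxtens_unindex b in
      let: (j, l) := mxtens_unindex jl in toeplitz N T (y j l) s n)).

(* Psi = I (x) [psi_1 ... psi_m] *)
Definition Psi (R : realType) (p1 p2 m N T : nat) (u : 'I_m -> nat -> R) :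
    'M[R]_(p1 * p2 * N, p1 * p2 * (m * T)) :=
  1%:M *t (\matrix_(s < N, b < m * T)
     (let: (i, n) := mxtens_unindex b in toeplitz N T (u i) s n)).

(* (Lambda, Gamma, Pi, Omega), each diagonal matrix D being represented by
   the row vector d of its diagonal entries, i.e., D = diag_mx d. *)
Definition hyperparam (R : realType) (p1 p2 m : nat) : Type :=
  ('rV[R]_(p1 * p1) * 'rV[R]_(p2 * p2) * 'rV[R]_p1 * 'rV[R]_(p2 * m))%type.

Definition lam (R : realType) (p1 p2 m : nat) (xi : hyperparam R p1 p2 m)
  (h j : 'I_p1) : R := xi.1.1.1 0 (mxtens_index (h, j)).
Definition gam (R : realType) (p1 p2 m : nat) (xi : hyperparam R p1 p2 m)
  (k l : 'I_p2) : R := xi.1.1.2 0 (mxtens_index (k, l)).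
Definition ppi (R : realType) (p1 p2 m : nat) (xi : hyperparam R p1 p2 m)
  (h : 'I_p1) : R := xi.1.2 0 h.
Definition omg (R : realType) (p1 p2 m : nat) (xi : hyperparam R p1 p2 m)
  (k : 'I_p2) (i : 'I_m) : R := xi.2 0 (mxtens_index (k, i)).

Definition Xi (R : realType) (p1 p2 m : nat) (kappa : R) :
    set (hyperparam R p1 p2 m) :=
  [set xi | [/\ forall h j, 0 <= lam xi h j <= kappa,
                forall k l, 0 <= gam xi k l <= kappa,
                forall h, 0 <= ppi xi h <= kappa &
                forall k i, 0 <= omg xi k i <= kappa]].

Definition hratio (R : realType) (a b : R) : R :=
  if (a == 0) || (b == 0) then 0 else a * b / (a + b).

Definition Kg (R : realType) (p1 p2 m T : nat) (P : 'M[R]_T)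
    (xi : hyperparam R p1 p2 m) : 'M[R]_(p1 * p2 * (p1 * p2 * T)) :=
  \matrix_(a, b)
    (let: (hk, c) := mxtens_unindex a in let: (jl, n) := mxtens_unindex c in
     let: (hk', c') := mxtens_unindex b in let: (jl', n') := mxtens_unindex c' in
     let: (h, k) := mxtens_unindex hk in let: (j, l) := mxtens_unindex jl in
     if (hk == hk') && (jl == jl')
     then hratio (lam xi h j) (gam xi k l) * P n n' else 0).

Definition Kf (R : realType) (p1 p2 m T : nat) (Rk : 'M[R]_T)
    (xi : hyperparam R p1 p2 m) : 'M[R]_(p1 * p2 * (m * T)) :=
  \matrix_(a, b)
    (let: (hk, c) := mxtens_unindex a in let: (i, n) := mxtens_unindex c in
     let: (hk', c') := mxtens_unindex b in let: (i', n') := mxtens_unindex c' in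
     let: (h, k) := mxtens_unindex hk in
     if (hk == hk') && (i == i')
     then hratio (ppi xi h) (omg xi k i) * Rk n n' else 0).

Definition Vmx (R : realType) (p1 p2 m N T : nat)
    (y : 'I_p1 -> 'I_p2 -> nat -> R) (u : 'I_m -> nat -> R)
    (P Rk : 'M[R]_T) (sigma2 : R) (xi : hyperparam R p1 p2 m) :
    'M[R]_(p1 * p2 * N) :=
  Phi N T y *m Kg P xi *m (Phi N T y)^T
  + Psi p1 p2 N T u *m Kf Rk xi *m (Psi p1 p2 N T u)^T
  + sigma2%:M.

(* Negative log-marginal likelihood; [sqnorm_inv V y] is y^T V^-1 y. *)
Definition ell (R : realType) (p1 p2 m N T : nat)
    (y : 'I_p1 -> 'I_p2 -> nat -> R) (u : 'I_m -> nat -> R)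
    (P Rk : 'M[R]_T) (sigma2 : R) (xi : hyperparam R p1 p2 m) : R :=
  ln (\det (Vmx N y u P Rk sigma2 xi))
  + 2^-1 * sqnorm_inv (Vmx N y u P Rk sigma2 xi) (yplus N y).

Definition regressor_assumption (R : realType) (p1 p2 m N T : nat)
    (y : 'I_p1 -> 'I_p2 -> nat -> R) (u : 'I_m -> nat -> R)
    (P Rk : 'M[R]_T) : Prop :=
  let SP : 'M[R]_(p1 * p2 * (p1 * p2 * T)) := 1%:M *t (1%:M *t sqrtmx P) in
  let SR : 'M[R]_(p1 * p2 * (m * T)) := 1%:M *t (1%:M *t sqrtmx Rk) in
  let F := Phi N T y in
  let G := Psi p1 p2 N T u in
  [/\ SP *m F^T *m F *m SP = N%:R%:M,
      SP *m F^T *m G *m SR = 0 &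
      SR *m G^T *m G *m SR = N%:R%:M].

Definition lsq (R : realType) (q r : nat) (A : 'M[R]_(q, r)) (b : 'cV[R]_q) :
  'cV[R]_r := invmx (A^T *m A) *m A^T *m b.

(* Block g^[hk,jl] of the least squares estimate of theta_g. *)
Definition gLS (R : realType) (p1 p2 N T : nat)
    (y : 'I_p1 -> 'I_p2 -> nat -> R)
    (h : 'I_p1) (k : 'I_p2) (j : 'I_p1) (l : 'I_p2) : 'cV[R]_T :=
  \col_n lsq (Phi N T y) (yplus N y)
    (mxtens_index (mxtens_index (h, k), mxtens_index (mxtens_index (j, l), n))) 0.

(* Block f^[hk,i] of the least squares estimate of theta_f. *)
Definition fLS (R : realType) (p1 p2 m N T : nat)
    (y : 'I_p1 -> 'I_p2 -> nat -> R) (u : 'I_m -> nat -> R)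
    (h : 'I_p1) (k : 'I_p2) (i : 'I_m) : 'cV[R]_T :=
  \col_n lsq (Psi p1 p2 N T u) (yplus N y)
    (mxtens_index (mxtens_index (h, k), mxtens_index (i, n))) 0.

(* Main.v *)
Require Import Defs.
From HB Require Import structures.
From mathcomp Require Import all_boot all_order all_algebra.
From mathcomp Require Import all_classical all_reals all_analysis.
From mathcomp Require Import mxtens ring.
Set Implicit Arguments.
Unset Strict Implicit.
Unset Printing Implicit Defensive.
Import Order.TTheory GRing.Theory Num.Theory.
Import numFieldNormedType.Exports.
Local Open Scope classical_set_scope.
Local Open Scope ring_scope.

(** The likelihood separates over the blocks of the kernel.  Let A and B be
    the regressors multiplied by the square roots of the kernels P and R.  The
    assumption says that the columns of [A B] are orthogonal with common
    squared norm N, while the kernels contribute a diagonal matrix that is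
    constant on blocks of size T.  Hence V = C diag(d) C^T + sigma^2 I with
    C = [A B] and C^T C = N I.  The identity between det (C X + s I) and
    det (X C + s I) and an explicit inverse of V then give
      ell = K + sum over the blocks of
              T ln (s + N r) - N^2 c r / (2 s (s + N r)),      s = sigma^2,
    where r is the ratio of hyperparameters of the block, and c is the squared
    norm of the least squares estimate of the block (ell_separable).

    Write x = N r / s.  Relative to r = 0, the cost of a block changes by
    T ln (1 + x) - (N c / (2 s)) x / (1 + x).  As ln (1 + x) >= x / (1 + x), this
    is nonnegative when N c <= T s, which is the hypothesis on the block
    (block_cost_ge).  A block that satisfies it is thus cheapest at r = 0.

    Finally ell is continuous on the compact set Xi, so it has a global
    minimizer there (separated_ell_argmin).  Setting to zero the hyperparameter
    under consideration only affects the blocks in which it occurs, all of which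
    satisfy the hypothesis, and sends their ratios to zero; the value does not
    increase (separated_ell_shrink), so the modified point is a global, hence
    local, minimizer that lies in the required subset. *)

(** * Diagonal updates of a scalar matrix *)

(** The Weinstein-Aronszajn identity in a division-free form.  The block matrix
    with rows (s I, A) and (-B, I) is triangularized by two column operations,
    one that clears -B and one that clears A; comparing determinants gives the
    two sides. *)
Lemma det_scalarD_mulmxC (R : comNzRingType) (q a : nat) (s : R)
    (A : 'M[R]_(q, a)) (B : 'M[R]_(a, q)) :
  \det (A *m B + s%:M) * s ^+ a = s ^+ q * \det (B *m A + s%:M).
Proof.
pose M := block_mx s%:M A (- B) 1%:M.
have detl : \det M = \det (A *m B + s%:M).
  have : \det (M *m block_mx 1%:M 0 B 1%:M) = \det (A *m B + s%:M).
    rewrite mulmx_block !mulmx1 !mulmx0 !mul1mx !add0r addNr.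
    by rewrite det_ublock det1 mulr1 addrC.
  by rewrite det_mulmx det_lblock !det1 !mulr1.
have : \det (M *m block_mx 1%:M (- A) 0 s%:M) = s ^+ q * \det (B *m A + s%:M).
  rewrite mulmx_block !mulmx1 !mulmx0 !mul1mx !addr0.
  rewrite mulmxN mul_scalar_mx mul_mx_scalar addNr mulNmx mulmxN opprK.
  by rewrite det_lblock det_scalar.
by rewrite det_mulmx det_ublock det1 det_scalar mul1r detl.
Qed.

Definition sqnorm (R : realType) (n : nat) (v : 'cV[R]_n) : R :=
  \sum_i v i 0 ^+ 2.

Lemma sqnormE (R : realType) (n : nat) (v : 'cV[R]_n) :
  sqnorm v = (v^T *m v) 0 0.
Proof. by rewrite mxE; apply: eq_bigr => i _; rewrite mxE expr2. Qed.

Lemma posdefmx_unit (R : realType) (n : nat) (Q : 'M[R]_n) :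
  posdefmx Q -> Q \in unitmx.
Proof.
move=> [Qsym Qpos]; rewrite -row_free_unit -kermx_eq0.
apply/eqP/row_matrixP => i; rewrite row0; apply/eqP/negPn/negP => ri_neq0.
have := Qpos (row i (kermx Q))^T; rewrite trmx_eq0 => /(_ ri_neq0).
by rewrite trmxK -row_mul mulmx_ker row0 mul0mx mxE ltxx.
Qed.

Lemma ln_prod (R : realType) (I : finType) (F : I -> R) :
  (forall i, 0 < F i) -> ln (\prod_i F i) = \sum_i ln (F i).
Proof.
move=> F_gt0.
apply: proj2 (_ : 0 < \prod_i F i /\ _).
elim/big_ind2: _ => [|x1 x2 y1 y2 [x1_gt0 <-] [y1_gt0 <-]|i _] //.
  by rewrite ln1 ltr01.
by rewrite mulr_gt0 // lnM.
Qed.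

(** The identity above trades the large determinant for that of C^T C diag(d) + s I,
    which is diagonal because the columns of C are orthogonal. *)
Lemma ln_det_diag_update (R : realType) (q a : nat) (nu s : R)
    (C : 'M[R]_(q, a)) (d : 'rV[R]_a) :
  0 < s -> C^T *m C = nu%:M -> (forall i, 0 < s + nu * d 0 i) ->
  ln (\det (C *m diag_mx d *m C^T + s%:M)) =
    ln s *+ q - ln s *+ a + \sum_i ln (s + nu * d 0 i).
Proof.
move=> s_gt0 CC den_gt0; set V := _ + s%:M.
have detV : \det V * s ^+ a = s ^+ q * \prod_i (s + nu * d 0 i).
  rewrite /V -mulmxA det_scalarD_mulmxC -mulmxA CC mul_mx_scalar.
  congr (_ * _); rewrite -diag_const_mx -!linearZ -linearD det_diag.
  by apply: eq_bigr => i _; rewrite !mxE addrC.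
have pr_gt0 : 0 < \prod_i (s + nu * d 0 i) by apply: prodr_gt0.
have sX_gt0 n : 0 < s ^+ n by rewrite exprn_gt0.
have detV_gt0 : 0 < \det V by rewrite -(pmulr_lgt0 _ (sX_gt0 a)) detV mulr_gt0.
have := congr1 (@ln R) detV.
rewrite (@lnM R _ _ detV_gt0 (sX_gt0 a)) (@lnM R _ _ (sX_gt0 q) pr_gt0).
rewrite !lnXn // ln_prod // => H.
by apply: (addIr (ln s *+ a)); rewrite H [RHS]addrAC subrK.
Qed.

(** The orthogonality of the columns of C makes the Woodbury formula explicit:
    the inverse is (I - C diag(e) C^T) / s with e = d / (s + nu d), since
    d (1 - nu e) = s e. *)
Lemma sqnorm_inv_diag_update (R : realType) (q a : nat) (nu s : R)
    (C : 'M[R]_(q, a)) (d : 'rV[R]_a) (v : 'cV[R]_q) :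
  s != 0 -> C^T *m C = nu%:M -> (forall i, s + nu * d 0 i != 0) ->
  sqnorm_inv (C *m diag_mx d *m C^T + s%:M) v =
    s^-1 * (sqnorm v - \sum_i d 0 i / (s + nu * d 0 i) * (C^T *m v) i 0 ^+ 2).
Proof.
move=> s_neq0 CC den_neq0; set V := _ + s%:M.
pose e : 'rV[R]_a := \row_i (d 0 i / (s + nu * d 0 i)).
pose W := s^-1 *: (1%:M - C *m diag_mx e *m C^T).
have VW : V *m W = 1%:M.
  have de : diag_mx d *m (1%:M - nu *: diag_mx e) = s *: diag_mx e.
    rewrite mul_diag_mx; apply/matrixP => i j; rewrite !mxE.
    case: (eqVneq i j) => [->|_]; last by rewrite !mulr0n !mulr0 subr0 mulr0.
    by rewrite !mulr1n; field; rewrite den_neq0.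
  have E : C *m diag_mx d *m C^T *m (C *m diag_mx e *m C^T)
         = C *m (diag_mx d *m (nu *: diag_mx e)) *m C^T.
    by rewrite -!mulmxA (mulmxA C^T) CC mul_scalar_mx -!scalemxAl -!scalemxAr.
  have E2 : C *m diag_mx d *m C^T - C *m (diag_mx d *m (nu *: diag_mx e)) *m C^T
         = s *: (C *m diag_mx e *m C^T).
    by rewrite -mulmxBl -mulmxBr -{1}(mulmx1 (diag_mx d)) -mulmxBr de -scalemxAr
      -scalemxAl.
  rewrite /W -scalemxAr mulmxBr mulmx1 {2}/V mulmxDl E mul_scalar_mx -E2.
  rewrite [_ + (_ - _)]addrC subrK /V [_ + s%:M]addrC addrK.
  by rewrite scale_scalar_mx mulVf.
have [Vu _] := mulmx1_unit VW.
have -> : sqnorm_inv V v = (v^T *m W *m v) 0 0.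
  by rewrite /sqnorm_inv -[W](mulKmx Vu) VW mulmx1.
rewrite /W -scalemxAr -scalemxAl mxE; congr (_ * _).
rewrite mulmxBr mulmxBl mulmx1 mxE -sqnormE [in LHS]mxE; congr (_ - _).
have -> : v^T *m (C *m diag_mx e *m C^T) *m v
        = (C^T *m v)^T *m (diag_mx e *m (C^T *m v)).
  by rewrite trmx_mul trmxK !mulmxA.
rewrite mxE; apply: eq_bigr => i _.
by rewrite mul_diag_mx !mxE; ring.
Qed.

(** * Separation of the likelihood *)

(** The part of the negative log-marginal likelihood due to T orthogonal
    regressors of squared norm nu that share the prior variance r, where w is
    the squared norm of the vector of their inner products with the data. *)
Definition block_cost (R : realType) (s nu : R) (T : nat) (w r : R) : R :=
  ln (s + nu * r) *+ T - r / (s + nu * r) * w / (2 * s).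

(** Two mutually orthogonal families of regressors are treated as the single
    family [A B]; each column then contributes a block of size 1. *)
Lemma marginal_likelihood_separable (R : realType) (q a b : nat) (nu s : R)
    (A : 'M[R]_(q, a)) (B : 'M[R]_(q, b)) (v : 'cV[R]_q) :
  0 < s -> 0 <= nu ->
  A^T *m A = nu%:M -> A^T *m B = 0 -> B^T *m B = nu%:M ->
  exists K : R, forall (d : 'rV[R]_a) (e : 'rV[R]_b),
    (forall i, 0 <= d 0 i) -> (forall i, 0 <= e 0 i) ->
    let V := A *m diag_mx d *m A^T + B *m diag_mx e *m B^T + s%:M in
    ln (\det V) + 2^-1 * sqnorm_inv V v =
      K + (\sum_i block_cost s nu 1 ((A^T *m v) i 0 ^+ 2) (d 0 i)
           + \sum_i block_cost s nu 1 ((B^T *m v) i 0 ^+ 2) (e 0 i)).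
Proof.
move=> s_gt0 nu_ge0 AA AB BB; pose C := row_mx A B.
have BA : B^T *m A = 0 by rewrite -[_ *m _]trmxK trmx_mul trmxK AB trmx0.
have CC : C^T *m C = nu%:M.
  by rewrite tr_row_mx mul_col_row AA AB BA BB -scalar_mx_block.
exists (ln s *+ q - ln s *+ (a + b) + sqnorm v / (2 * s)) => d e d_ge0 e_ge0 V.
pose f := row_mx d e.
have f_ge0 i : 0 <= f 0 i.
  by rewrite -(splitK i); case: (fintype.split i) => j; rewrite /f ?row_mxEl ?row_mxEr.
have den_gt0 i : 0 < s + nu * f 0 i by rewrite ltr_pwDl // mulr_ge0.
have VE : V = C *m diag_mx f *m C^T + s%:M.
  rewrite /f diag_mx_row tr_row_mx mul_row_block !mulmx0 add0r addr0.
  by rewrite mul_row_col.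
rewrite VE (ln_det_diag_update s_gt0 CC den_gt0).
rewrite (sqnorm_inv_diag_update _ (lt0r_neq0 s_gt0) CC); last first.
  by move=> i; exact: lt0r_neq0.
have -> : \sum_i block_cost s nu 1 ((A^T *m v) i 0 ^+ 2) (d 0 i)
        + \sum_i block_cost s nu 1 ((B^T *m v) i 0 ^+ 2) (e 0 i)
        = \sum_i block_cost s nu 1 ((C^T *m v) i 0 ^+ 2) (f 0 i).
  rewrite big_split_ord tr_row_mx mul_col_mx.
  by congr (_ + _); apply: eq_bigr => i _;
     rewrite ?col_mxEu ?col_mxEd ?row_mxEl ?row_mxEr.
rewrite /block_cost sumrB -!mulr_suml.
set L := \sum_i ln _; set Q := \sum_i _ * _.
have s_neq0 : s != 0 by rewrite gt_eqF.
move: (ln s *+ _ - _) (sqnorm v) => k n2.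
by field.
Qed.

(** * Vectors and matrices with repeated blocks *)

Lemma sum_mxtens_index (V : nmodType) (a b : nat) (F : 'I_(a * b) -> V) :
  \sum_i F i = \sum_i \sum_j F (mxtens_index (i, j)).
Proof.
rewrite pair_big; apply: reindex => /=.
exists (@mxtens_unindex a b) => [] [i j] _; first by rewrite mxtens_indexK.
exact: (mxtens_unindexK (Ordinal _)).
Qed.

Section Blocks.
Context {R : realType} {n b T : nat}.

Definition block_index (i : 'I_n) (j : 'I_b) (t : 'I_T) : 'I_(n * (b * T)) :=
  mxtens_index (i, mxtens_index (j, t)).

Definition block_unindex (a : 'I_(n * (b * T))) : 'I_n * ('I_b * 'I_T) :=
  ((mxtens_unindex a).1, mxtens_unindex (mxtens_unindex a).2).

Lemma block_indexK i j t : block_unindex (block_index i j t) = (i, (j, t)).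
Proof. by rewrite /block_unindex !mxtens_indexK. Qed.

Definition blockwise (r : 'I_n -> 'I_b -> R) : 'rV[R]_(n * (b * T)) :=
  \row_a r (block_unindex a).1 (block_unindex a).2.1.

Lemma blockwiseE r i j t : blockwise r 0 (block_index i j t) = r i j.
Proof. by rewrite mxE block_indexK. Qed.

Definition block_col (v : 'cV[R]_(n * (b * T))) (i : 'I_n) (j : 'I_b) : 'cV[R]_T :=
  \col_t v (block_index i j t) 0.

Definition repeat_mx (S : 'M[R]_T) : 'M[R]_(n * (b * T)) := 1%:M *t (1%:M *t S).

Lemma repeat_mxE S i j t i' j' t' :
  repeat_mx S (block_index i j t) (block_index i' j' t') =
    if (i == i') && (j == j') then S t t' else 0.
Proof.
rewrite /repeat_mx /block_index !tensmxE !mxE.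
by case: (i == i'); case: (j == j'); rewrite /= ?(mulr1n, mulr0n, mul1r, mul0r, mulr0).
Qed.

Lemma blockP (P : 'I_(n * (b * T)) -> Prop) :
  (forall i j t, P (block_index i j t)) -> forall a, P a.
Proof.
move=> PH a; case: (mxtens_indexP a) => i c; case: (mxtens_indexP c) => j t; exact: PH.
Qed.

Lemma repeat_mx_mul S S' : repeat_mx (S *m S') = repeat_mx S *m repeat_mx S'.
Proof. by rewrite !tensmx_mul !mulmx1. Qed.

Lemma tr_repeat_mx S : (repeat_mx S)^T = repeat_mx S^T.
Proof. by rewrite !trmx_tens !trmx1. Qed.

(** Both factors are block diagonal, and the first one is scalar on each block. *)
Lemma diag_blockwiseC r S :
  diag_mx (blockwise r) *m repeat_mx S = repeat_mx S *m diag_mx (blockwise r).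
Proof.
rewrite mul_diag_mx mul_mx_diag; apply/matrixP; elim/blockP => i j t.
elim/blockP => i' j' t'; rewrite mxE [RHS]mxE !blockwiseE repeat_mxE.
by case: andP => [[/eqP -> /eqP ->]|_]; rewrite ?mulr0 ?mul0r // mulrC.
Qed.

Lemma block_col_repeat_mx S v i j :
  block_col (repeat_mx S *m v) i j = S *m block_col v i j.
Proof.
apply/colP => t; rewrite mxE !mxE sum_mxtens_index (bigD1 i) //=.
rewrite [X in _ + X]big1 ?addr0 => [|i' i'i]; last first.
  by rewrite sum_mxtens_index big1 // => j' _; rewrite big1 // => t' _;
    rewrite repeat_mxE eq_sym (negPf i'i) mul0r.
rewrite sum_mxtens_index (bigD1 j) //=.
rewrite [X in _ + X]big1 ?addr0 => [|j' j'j]; last first.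
  by rewrite big1 // => t' _; rewrite repeat_mxE eqxx [j == _]eq_sym (negPf j'j) mul0r.
by apply: eq_bigr => t' _; rewrite repeat_mxE !eqxx mxE.
Qed.

Lemma sum_block_cost (s nu : R) (z : 'cV[R]_(n * (b * T))) (r : 'I_n -> 'I_b -> R) :
  \sum_a block_cost s nu 1 (z a 0 ^+ 2) (blockwise r 0 a) =
  \sum_i \sum_j block_cost s nu T (sqnorm (block_col z i j)) (r i j).
Proof.
rewrite sum_mxtens_index; apply: eq_bigr => i _.
rewrite sum_mxtens_index; apply: eq_bigr => j _.
under eq_bigr do rewrite blockwiseE.
rewrite /block_cost sumrB sumr_const card_ord; congr (_ - _).
rewrite -!mulr_suml -mulr_sumr; congr (_ * _ / _).
by apply: eq_bigr => t _; rewrite mxE.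
Qed.

(** Write W for the block diagonal matrix with blocks S.  The orthogonality
    assumption says that the inverse of F^T F is W W / nu, so the least squares
    estimate is W z / nu with z = (F W)^T v, and the factor S in each block of W z
    cancels the kernel S S of the norm. *)
Lemma sqnorm_inv_lsq q (F : 'M[R]_(q, n * (b * T))) (S : 'M[R]_T) (nu : R)
    (v : 'cV[R]_q) i j :
  posdefmx S -> nu != 0 ->
  repeat_mx S *m F^T *m F *m repeat_mx S = nu%:M ->
  nu ^+ 2 * sqnorm_inv (S *m S) (block_col (lsq F v) i j) =
    sqnorm (block_col ((F *m repeat_mx S)^T *m v) i j).
Proof.
move=> Spos nu_neq0 orth; have Su := posdefmx_unit Spos.
have [Ssym _] := Spos; set W := repeat_mx S in orth *.
have WFFW : W *m (F^T *m F *m W) = nu%:M by rewrite !mulmxA.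
have inv : F^T *m F *m (nu^-1 *: (W *m W)) = 1%:M.
  have : W *m (nu^-1 *: (F^T *m F *m W)) = 1%:M.
    by rewrite -scalemxAr WFFW scale_scalar_mx mulVf.
  by move/mulmx1C; rewrite -scalemxAl -scalemxAr !mulmxA.
have lsqE : lsq F v = nu^-1 *: (W *m ((F *m W)^T *m v)).
  have [FFu _] := mulmx1_unit inv.
  rewrite /lsq -[invmx _]mulmx1 -inv mulKmx // trmx_mul tr_repeat_mx Ssym -/W.
  by rewrite -!scalemxAl !mulmxA.
rewrite lsqE -linearZ block_col_repeat_mx; set z := _ *m v.
have -> : block_col (nu^-1 *: z) i j = nu^-1 *: block_col z i j.
  by apply/colP => t; rewrite !mxE.
set x := block_col z i j.
have SQS : S *m (invmx (S *m S) *m S) = 1%:M.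
  by apply/mulmx1C; rewrite -mulmxA mulVmx // unitmx_mul Su.
rewrite /sqnorm_inv -scalemxAr.
have -> : (nu^-1 *: (S *m x))^T = nu^-1 *: (x^T *m S).
  by rewrite -[in RHS]Ssym -trmx_mul; apply/rowP => t; rewrite !mxE.
have -> : nu^-1 *: (x^T *m S) *m invmx (S *m S) *m (nu^-1 *: (S *m x))
        = (nu^-1 * nu^-1) *: (x^T *m (S *m (invmx (S *m S) *m S)) *m x).
  by rewrite -!scalemxAl -scalemxAr scalerA !mulmxA.
rewrite SQS mulmx1 mxE -sqnormE.
by field.
Qed.
End Blocks.
Arguments repeat_mx {R} n b {T} S.
Arguments blockwise {R n b} T r.

(** * Kernels and square roots *)

(** The default value of the choice in the definition of the square root
    is 0, so a nonzero value is a true square root. *)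
Lemma sqrtmxP (R : realType) (n : nat) (Q : 'M[R]_n) :
  sqrtmx Q != 0 -> posdefmx (sqrtmx Q) /\ sqrtmx Q *m sqrtmx Q = Q.
Proof.
rewrite /sqrtmx; have [[S QS]|noS] := pselect (exists S : 'M[R]_n, posdefmx S /\ S *m S = Q).
  by move=> _; case: xgetP => // /(_ S).
rewrite xgetPN ?eqxx// => S QS.
by apply: noS; exists S.
Qed.

(** The orthogonality assumption on the regressors already forces the square root
    of the kernel to be nonzero, hence to be a true square root.  The dimensions must be
    positive because every matrix without entries is zero. *)
Lemma repeat_mx_orth_neq0 (R : realType) (n b T q N : nat) (F : 'M[R]_(q, n * (b * T)))
    (S : 'M[R]_T) :
  (0 < n * (b * T))%N -> (0 < N)%N ->
  repeat_mx n b S *m F^T *m F *m repeat_mx n b S = N%:R%:M -> S != 0.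
Proof.
move=> dim_gt0 N_gt0 orth; apply: contra_eq_neq orth => ->.
rewrite /repeat_mx !tensmx0 !mul0mx; apply/eqP => /matrixP.
move=> /(_ (Ordinal dim_gt0) (Ordinal dim_gt0)); rewrite !mxE eqxx mulr1n.
by move/esym/eqP; rewrite pnatr_eq0 -leqn0 leqNgt N_gt0.
Qed.

Definition ratio_g (R : realType) (p1 p2 m : nat) (xi : hyperparam R p1 p2 m)
    (hk jl : 'I_(p1 * p2)) : R :=
  hratio (lam xi (mxtens_unindex hk).1 (mxtens_unindex jl).1)
         (gam xi (mxtens_unindex hk).2 (mxtens_unindex jl).2).

Definition ratio_f (R : realType) (p1 p2 m : nat) (xi : hyperparam R p1 p2 m)
    (hk : 'I_(p1 * p2)) (i : 'I_m) : R :=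
  hratio (ppi xi (mxtens_unindex hk).1) (omg xi (mxtens_unindex hk).2 i).

Lemma KgE (R : realType) (p1 p2 m T : nat) (P : 'M[R]_T) (xi : hyperparam R p1 p2 m) :
  Kg P xi = diag_mx (blockwise T (ratio_g xi)) *m repeat_mx _ _ P.
Proof.
(* The entry is a function of decoded indices, so that decoding cancels against
   the encoding of the nested index. *)
pose entry (X Y : 'I_(p1 * p2) * ('I_(p1 * p2) * 'I_T)) :=
  if (X.1 == Y.1) && (X.2.1 == Y.2.1)
  then ratio_g xi X.1 X.2.1 * P X.2.2 Y.2.2 else 0.
rewrite mul_diag_mx; apply/matrixP.
elim/(@blockP (p1 * p2) (p1 * p2) T) => hk jl t.
elim/(@blockP (p1 * p2) (p1 * p2) T) => hk' jl' t'.
rewrite [RHS]mxE blockwiseE repeat_mxE.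
transitivity (entry (hk, (jl, t)) (hk', (jl', t'))).
  by rewrite -!block_indexK mxE.
by rewrite /entry; case: ifP => // _; rewrite mulr0.
Qed.

Lemma KfE (R : realType) (p1 p2 m T : nat) (Rk : 'M[R]_T) (xi : hyperparam R p1 p2 m) :
  Kf Rk xi = diag_mx (blockwise T (ratio_f xi)) *m repeat_mx _ _ Rk.
Proof.
pose entry (X Y : 'I_(p1 * p2) * ('I_m * 'I_T)) :=
  if (X.1 == Y.1) && (X.2.1 == Y.2.1)
  then ratio_f xi X.1 X.2.1 * Rk X.2.2 Y.2.2 else 0.
rewrite mul_diag_mx; apply/matrixP.
elim/(@blockP (p1 * p2) m T) => hk i t.
elim/(@blockP (p1 * p2) m T) => hk' i' t'.
rewrite [RHS]mxE blockwiseE repeat_mxE.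
transitivity (entry (hk, (i, t)) (hk', (i', t'))).
  by rewrite -!block_indexK mxE.
by rewrite /entry; case: ifP => // _; rewrite mulr0.
Qed.

(** One factor S of the kernel moves across the block scalar matrix, so that each
    side of the sandwich receives its own S. *)
Lemma sandwich_repeat_mx (R : realType) (n b T q : nat) (F : 'M[R]_(q, n * (b * T)))
    (S : 'M[R]_T) (r : 'I_n -> 'I_b -> R) :
  S^T = S ->
  let A := F *m repeat_mx n b S in
  F *m (diag_mx (blockwise T r) *m repeat_mx n b (S *m S)) *m F^T =
    A *m diag_mx (blockwise T r) *m A^T.
Proof.
move=> Ssym A; rewrite repeat_mx_mul (mulmxA (diag_mx _)) diag_blockwiseC.
by rewrite /A trmx_mul tr_repeat_mx Ssym !mulmxA.
Qed.

Lemma hratio_ge0 (R : realType) (a b : R) : 0 <= a -> 0 <= b -> 0 <= hratio a b.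
Proof.
by move=> a0 b0; rewrite /hratio; case: ifP => // _; rewrite divr_ge0 ?mulr_ge0 ?addr_ge0.
Qed.

Lemma ratio_ge0 (R : realType) (p1 p2 m : nat) kappa (xi : hyperparam R p1 p2 m) :
  Xi kappa xi -> (forall hk jl, 0 <= ratio_g xi hk jl) /\ (forall hk i, 0 <= ratio_f xi hk i).
Proof.
case=> lamP gamP ppiP omgP; split => [hk jl|hk i]; apply: hratio_ge0.
- by case/andP: (lamP (mxtens_unindex hk).1 (mxtens_unindex jl).1).
- by case/andP: (gamP (mxtens_unindex hk).2 (mxtens_unindex jl).2).
- by case/andP: (ppiP (mxtens_unindex hk).1).
- by case/andP: (omgP (mxtens_unindex hk).2 i).
Qed.

(** * Hyperparameter ratios, block costs and the compact set of hyperparameters *)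

(** Both sides vanish when a or b does, because division by zero yields zero. *)
Lemma hratioE (R : realType) (a b : R) : hratio a b = a * b / (a + b).
Proof.
by rewrite /hratio; case: eqVneq => [->|_]; case: eqVneq => [->|_] //=;
  rewrite ?(mulr0, mul0r).
Qed.

Lemma hratio_norm_le (R : realType) (a b : R) : hratio `|a| `|b| <= `|a|.
Proof.
rewrite hratioE; have [->|a_neq0] := eqVneq a 0; first by rewrite normr0 !mul0r.
have ab_gt0 : 0 < `|a| + `|b| by rewrite ltr_pwDl ?normr_gt0.
by rewrite ler_pdivrMr // ler_wpM2l // lerDr.
Qed.

(** The absolute values extend the ratio continuously from nonnegative arguments
    to the whole plane.  At the origin, where the denominator vanishes,
    continuity comes from the bound of the ratio by its first argument. *)
Lemma cvg_hratio_norm (R : realType) (X : Type) (F : set_system X) (FF : Filter F)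
    (f g : X -> R) (a b : R) :
  f @ F --> a -> g @ F --> b ->
  (fun x => hratio `|f x| `|g x|) @ F --> hratio `|a| `|b|.
Proof.
move=> fa gb.
have nfa : (fun x => `|f x|) @ F --> `|a| by exact: cvg_norm.
have ngb : (fun x => `|g x|) @ F --> `|b| by exact: cvg_norm.
have [ab_eq0|ab_neq0] := eqVneq (`|a| + `|b|) 0.
  have a0 : a = 0.
    by apply/eqP; rewrite -normr_le0 -ab_eq0 lerDl normr_ge0.
  rewrite hratioE ab_eq0 invr0 mulr0.
  apply: (@squeeze_cvgr _ _ _ _ (fun=> 0) (fun x => `|f x|)).
  - by apply: nearW => x; rewrite hratio_norm_le hratio_ge0.
  - exact: cvg_cst.
  - by move: nfa; rewrite a0 normr0.
rewrite hratioE; under eq_cvg do rewrite hratioE.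
by apply: cvgM; [exact: cvgM|apply: cvgV => //; exact: cvgD].
Qed.

Lemma cvg_block_cost (R : realType) (X : Type) (F : set_system X) (FF : Filter F)
    (s nu w : R) (T : nat) (f : X -> R) (r : R) :
  0 < s + nu * r -> f @ F --> r ->
  (fun x => block_cost s nu T w (f x)) @ F --> block_cost s nu T w r.
Proof.
move=> den_gt0 fr.
have den : (fun x => s + nu * f x) @ F --> s + nu * r.
  by apply: cvgD; [exact: cvg_cst|apply: cvgM => //; exact: cvg_cst].
apply: cvgB.
  apply: cvgMn; apply: (cvg_comp _ _ den); exact: continuous_ln.
apply: cvgM; last exact: cvg_cst.
apply: cvgM; last exact: cvg_cst.
by apply: cvgM => //; apply: cvgV => //; rewrite gt_eqF.
Qed.

(** With x = nu r / s, the increase of the logarithm, ln (1 + x), is at least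
    x / (1 + x), while the data term decreases by at most
    (T / 2) x / (1 + x). *)
Lemma block_cost_ge (R : realType) (s nu : R) (T : nat) (c r : R) :
  0 < s -> 0 < nu -> 0 <= r -> c <= T%:R / nu * s ->
  block_cost s nu T (nu ^+ 2 * c) 0 <= block_cost s nu T (nu ^+ 2 * c) r.
Proof.
move=> s_gt0 nu_gt0 r_ge0 c_le.
have den_gt0 : 0 < s + nu * r by rewrite ltr_pwDl // mulr_ge0 // ltW.
have s_neq0 := gt_eqF s_gt0.
rewrite /block_cost mulr0 addr0 mul0r mul0r mul0r subr0.
rewrite lerBrDr -lerBrDl -mulrnBl -(@ln_div R) ?posrE //.
(* ln t <= t - 1 at t = s / (s + nu r). *)
have nux : nu * r / (s + nu * r) <= ln ((s + nu * r) / s).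
  have : ln (1 + (- (nu * r / (s + nu * r)))) <= - (nu * r / (s + nu * r)).
    apply: le_ln1Dx; rewrite ltrN2 ltr_pdivrMr // mul1r ltrDr //.
  have -> : 1 - nu * r / (s + nu * r) = ((s + nu * r) / s)^-1.
    by field; rewrite s_neq0 gt_eqF.
  by rewrite lnV ?posrE ?divr_gt0 // lerN2.
rewrite -[leRHS]mulr_natl.
apply: le_trans (ler_wpM2l (ler0n _ T) nux).
have nuc : nu * c <= T%:R * s by move: c_le; rewrite mulrAC ler_pdivlMr // mulrC.
have -> : r / (s + nu * r) * (nu ^+ 2 * c) / (2 * s)
        = nu * r / (s + nu * r) * (nu * c / (2 * s)).
  by field; rewrite s_neq0 gt_eqF.
rewrite [leRHS]mulrC; apply: ler_wpM2l.
  by rewrite divr_ge0 ?mulr_ge0 // ltW.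
rewrite ler_pdivrMr ?mulr_gt0 //; apply: (le_trans nuc).
by rewrite ler_wpM2l // ler_peMl // ?ltW // ltr1n.
Qed.

Lemma compact_Xi (R : realType) (p1 p2 m : nat) (kappa : R) :
  compact (@Xi R p1 p2 m kappa).
Proof.
pose box n := [set v : 'rV[R]_n | forall i, `[0, kappa]%classic (v ord0 i)].
have box_compact n : compact (box n).
  by apply: (@rV_compact _ n (fun=> `[0, kappa]%classic)) => i; exact: segment_compact.
have -> : @Xi R p1 p2 m kappa =
    box (p1 * p1)%N `*` box (p2 * p2)%N `*` box p1 `*` box (p2 * m)%N.
  apply/seteqP; split => xi.
    case=> Hl Hg Hp Ho; split; [split; [split|]|] => i /=; rewrite in_itv /=.
    - by case: (mxtens_indexP i) => h j; exact: Hl.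
    - by case: (mxtens_indexP i) => k l; exact: Hg.
    - exact: Hp.
    - by case: (mxtens_indexP i) => k j; exact: Ho.
  case=> [[[Hl Hg] Hp] Ho]; split.
  - by move=> h j; have := Hl (mxtens_index (h, j)); rewrite /= in_itv.
  - by move=> k l; have := Hg (mxtens_index (k, l)); rewrite /= in_itv.
  - by move=> h; have := Hp h; rewrite /= in_itv.
  - by move=> k i; have := Ho (mxtens_index (k, i)); rewrite /= in_itv.
by do 3 (apply: compact_setX; last exact: box_compact).
Qed.

(** Precomposing with absolute values turns continuity on the set Xi into
    continuity everywhere, without changing anything on Xi. *)
Definition norm_hyperparam (R : realType) (p1 p2 m : nat) (xi : hyperparam R p1 p2 m) :
    hyperparam R p1 p2 m :=
  (map_mx Num.norm xi.1.1.1, map_mx Num.norm xi.1.1.2,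
   map_mx Num.norm xi.1.2, map_mx Num.norm xi.2).

Lemma norm_hyperparam_id (R : realType) (p1 p2 m : nat) kappa (xi : hyperparam R p1 p2 m) :
  Xi kappa xi -> norm_hyperparam xi = xi.
Proof.
case: xi => [[[L G] p] o] [Hl Hg Hp Ho]; rewrite /norm_hyperparam /=.
congr (_, _, _, _); apply/rowP => i; rewrite mxE ger0_norm //.
- by case: (mxtens_indexP i) => h j; case/andP: (Hl h j).
- by case: (mxtens_indexP i) => k l; case/andP: (Hg k l).
- by case/andP: (Hp i).
- by case: (mxtens_indexP i) => k j; case/andP: (Ho k j).
Qed.

(** * The likelihood of the model and its minimizer *)

Section SeparatedLikelihood.
Context (R : realType) (p1 p2 m N T : nat) (y : 'I_p1 -> 'I_p2 -> nat -> R)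
  (u : 'I_m -> nat -> R) (P Rk : 'M[R]_T) (s : R) (kappa : R).

Definition weight_g (hk jl : 'I_(p1 * p2)) : R :=
  N%:R ^+ 2 * sqnorm_inv P (gLS N T y (mxtens_unindex hk).1 (mxtens_unindex hk).2
     (mxtens_unindex jl).1 (mxtens_unindex jl).2).

Definition weight_f (hk : 'I_(p1 * p2)) (i : 'I_m) : R :=
  N%:R ^+ 2 * sqnorm_inv Rk (fLS N T y u (mxtens_unindex hk).1 (mxtens_unindex hk).2 i).

Definition separated_ell (xi : hyperparam R p1 p2 m) : R :=
  \sum_hk \sum_jl block_cost s N%:R T (weight_g hk jl) (ratio_g xi hk jl) +
  \sum_hk \sum_i block_cost s N%:R T (weight_f hk i) (ratio_f xi hk i).

(** The square roots of P and R split each kernel evenly between the regressors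
    on its two sides, which makes V a diagonal update along orthogonal columns.
    Regrouping the columns by blocks turns the inner products with the data into
    the norms of the least squares estimates. *)
Lemma ell_separable :
  (0 < p1)%N -> (0 < p2)%N -> (0 < m)%N -> (0 < T)%N -> (0 < N)%N -> 0 < s ->
  regressor_assumption N y u P Rk ->
  exists K : R, forall xi, Xi kappa xi -> ell N y u P Rk s xi = K + separated_ell xi.
Proof.
move=> p1_gt0 p2_gt0 m_gt0 T_gt0 N_gt0 s_gt0 [FF FG GG].
have dimg_gt0 : (0 < p1 * p2 * (p1 * p2 * T))%N.
  by rewrite !muln_gt0 p1_gt0 p2_gt0 T_gt0.
have dimf_gt0 : (0 < p1 * p2 * (m * T))%N.
  by rewrite !muln_gt0 p1_gt0 p2_gt0 m_gt0 T_gt0.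
have [Ppos PE] := sqrtmxP (repeat_mx_orth_neq0 dimg_gt0 N_gt0 FF).
have [Rpos RE] := sqrtmxP (repeat_mx_orth_neq0 dimf_gt0 N_gt0 GG).
have PE' := esym PE; have RE' := esym RE.
set SP := sqrtmx P in FF FG Ppos PE PE'.
set SR := sqrtmx Rk in FG GG Rpos RE RE'.
pose A := Phi N T y *m repeat_mx (p1 * p2) (p1 * p2) SP.
pose B := Psi p1 p2 N T u *m repeat_mx (p1 * p2) m SR.
have trA : A^T = repeat_mx _ _ SP *m (Phi N T y)^T.
  by rewrite trmx_mul tr_repeat_mx (proj1 Ppos).
have trB : B^T = repeat_mx _ _ SR *m (Psi p1 p2 N T u)^T.
  by rewrite trmx_mul tr_repeat_mx (proj1 Rpos).
have AA : A^T *m A = N%:R%:M by rewrite trA !mulmxA.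
have AB : A^T *m B = 0 by rewrite trA !mulmxA.
have BB : B^T *m B = N%:R%:M by rewrite trB !mulmxA.
have N_neq0 : N%:R != 0 :> R by rewrite pnatr_eq0 -lt0n.
have [K HK] := marginal_likelihood_separable (yplus N y) s_gt0 (ler0n _ N) AA AB BB.
exists K => xi /ratio_ge0[rg_ge0 rf_ge0].
have VE : Vmx N y u P Rk s xi =
    A *m diag_mx (blockwise T (ratio_g xi)) *m A^T
    + B *m diag_mx (blockwise T (ratio_f xi)) *m B^T + s%:M.
  rewrite /Vmx KgE KfE PE' RE' (sandwich_repeat_mx _ _ (proj1 Ppos)).
  by rewrite (sandwich_repeat_mx _ _ (proj1 Rpos)).
rewrite /ell VE HK; try by move=> i; rewrite mxE.
congr (_ + _); rewrite !sum_block_cost; congr (_ + _).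
  apply: eq_bigr => hk _; apply: eq_bigr => jl _; congr block_cost.
  rewrite -(sqnorm_inv_lsq _ _ _ Ppos N_neq0 FF) PE /weight_g; congr (_ * sqnorm_inv _ _).
  apply/colP => t; rewrite !mxE /block_index.
  by case: (mxtens_indexP hk) => h k; case: (mxtens_indexP jl) => j l; rewrite !mxtens_indexK.
apply: eq_bigr => hk _; apply: eq_bigr => i _; congr block_cost.
rewrite -(sqnorm_inv_lsq _ _ _ Rpos N_neq0 GG) RE /weight_f; congr (_ * sqnorm_inv _ _).
apply/colP => t; rewrite !mxE /block_index.
by case: (mxtens_indexP hk) => h k; rewrite !mxtens_indexK.
Qed.

Let sep := separated_ell.

Lemma continuous_separated_ell : 0 < s ->
  continuous (fun xi : hyperparam R p1 p2 m => sep (norm_hyperparam xi)).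
Proof.
move=> s_gt0 xi.
have coord n (f : hyperparam R p1 p2 m -> 'rV[R]_n) i :
    f @ xi --> f xi -> (fun z => f z 0 i) @ xi --> f xi 0 i.
  move=> fc; exact: (cvg_comp _ _ fc (@coord_continuous R 1 n 0 i (f xi))).
have fstc (X Z : topologicalType) (z : X * Z) : fst @ z --> z.1 by exact: cvg_fst.
have sndc (X Z : topologicalType) (z : X * Z) : snd @ z --> z.2 by exact: cvg_snd.
have fst2 : (fun z : hyperparam R p1 p2 m => z.1.1) @ xi --> xi.1.1.
  exact: (cvg_comp _ _ (fstc _ _ xi) (fstc _ _ xi.1)).
have lam_cvg h j : lam z h j @[z --> xi] --> lam xi h j.
  apply: (coord _ (fun z => z.1.1.1)).
  exact: (cvg_comp _ _ fst2 (fstc _ _ xi.1.1)).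
have gam_cvg k l : gam z k l @[z --> xi] --> gam xi k l.
  apply: (coord _ (fun z => z.1.1.2)).
  exact: (cvg_comp _ _ fst2 (sndc _ _ xi.1.1)).
have ppi_cvg h : ppi z h @[z --> xi] --> ppi xi h.
  apply: (coord _ (fun z => z.1.2)).
  exact: (cvg_comp _ _ (fstc _ _ xi) (sndc _ _ xi.1)).
have omg_cvg k i : omg z k i @[z --> xi] --> omg xi k i.
  by apply: (coord _ (fun z => z.2)); exact: sndc.
have den_gt0 (a b : R) : 0 < s + N%:R * hratio `|a| `|b|.
  by rewrite ltr_pwDl // mulr_ge0 // hratio_ge0.
apply: cvgD; (apply: cvg_big => [|hk _]; first exact: add_continuous);
  (apply: cvg_big => [|jl _]; first exact: add_continuous).
  have E z : ratio_g (norm_hyperparam z) hk jl = hratio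
      `|lam z (mxtens_unindex hk).1 (mxtens_unindex jl).1|
      `|gam z (mxtens_unindex hk).2 (mxtens_unindex jl).2|.
    by rewrite /ratio_g {1}/lam {1}/gam !mxE.
  apply: cvg_block_cost; rewrite E //.
  by under eq_cvg do rewrite E; exact: cvg_hratio_norm.
have E z : ratio_f (norm_hyperparam z) hk jl = hratio
    `|ppi z (mxtens_unindex hk).1| `|omg z (mxtens_unindex hk).2 jl|.
  by rewrite /ratio_f {1}/ppi {1}/omg !mxE.
apply: cvg_block_cost; rewrite E //.
by under eq_cvg do rewrite E; exact: cvg_hratio_norm.
Qed.

Lemma separated_ell_argmin : 0 < s -> 0 < kappa ->
  exists2 xi, Xi kappa xi & forall z, Xi kappa z -> sep xi <= sep z.
Proof.
move=> s_gt0 kappa_gt0.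
have Xi0 : @Xi R p1 p2 m kappa !=set0.
  exists (0, 0, 0, 0); split => *; rewrite /lam /gam /ppi /omg /= mxE lexx;
  exact: ltW.
have cont : {within @Xi R p1 p2 m kappa, continuous sep}.
  apply: (subspace_eq_continuous (f := fun z => sep (norm_hyperparam z))); last first.
    by apply: continuous_subspaceT; exact: continuous_separated_ell.
  by move=> xi /set_mem xiXi /=; rewrite (norm_hyperparam_id xiXi).
have [xi /set_mem xiXi min] := compact_EVT_min Xi0 (@compact_Xi R p1 p2 m kappa) cont.
by exists xi => // z zXi; apply: min; rewrite inE.
Qed.

(** The comparison is made block by block.  The alternatives are those that arise
    when one hyperparameter is set to zero: a block either does not involve it
    and keeps its ratio, or is switched off. *)
Lemma separated_ell_shrink xi xi' : 0 < s -> (0 < N)%N -> Xi kappa xi ->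
  (forall h k j l,
     hratio (lam xi' h j) (gam xi' k l) = hratio (lam xi h j) (gam xi k l) \/
     hratio (lam xi' h j) (gam xi' k l) = 0 /\
     0 <= T%:R / N%:R * s - sqnorm_inv P (gLS N T y h k j l)) ->
  (forall h k i,
     hratio (ppi xi' h) (omg xi' k i) = hratio (ppi xi h) (omg xi k i) \/
     hratio (ppi xi' h) (omg xi' k i) = 0 /\
     0 <= T%:R / N%:R * s - sqnorm_inv Rk (fLS N T y u h k i)) ->
  sep xi' <= sep xi.
Proof.
move=> s_gt0 N_gt0 /ratio_ge0[rg_ge0 rf_ge0] Hg Hf.
have nu_gt0 : 0 < N%:R :> R by rewrite ltr0n.
apply: lerD; apply: ler_sum => hk _; apply: ler_sum => jl _.
  rewrite {1}/ratio_g; case: (Hg (mxtens_unindex hk).1 (mxtens_unindex hk).2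
    (mxtens_unindex jl).1 (mxtens_unindex jl).2) => [->//|[-> c_le]].
  by apply: block_cost_ge => //; rewrite -subr_ge0.
rewrite {1}/ratio_f; case: (Hf (mxtens_unindex hk).1 (mxtens_unindex hk).2 jl)
  => [->//|[-> c_le]].
by apply: block_cost_ge => //; rewrite -subr_ge0.
Qed.

End SeparatedLikelihood.

(** * Switching off one hyperparameter *)

Definition zero_coord (R : realType) (n : nat) (v : 'rV[R]_n) (a : 'I_n) : 'rV[R]_n :=
  \row_i (if i == a then 0 else v 0 i).

Lemma zero_coordE (R : realType) (n : nat) (v : 'rV[R]_n) (a i : 'I_n) :
  zero_coord v a 0 i = if i == a then 0 else v 0 i.
Proof. exact: mxE. Qed.

Lemma zero_coord_bounds (R : realType) (n : nat) (v : 'rV[R]_n) (a i : 'I_n) (kappa : R) :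
  0 <= v 0 i <= kappa -> 0 <= zero_coord v a 0 i <= kappa.
Proof.
by rewrite zero_coordE => /andP[v0 vk]; case: ifP => _; rewrite ?lexx ?v0 // (le_trans v0).
Qed.

Lemma hratio0l (R : realType) (a : R) : hratio 0 a = 0.
Proof. by rewrite /hratio eqxx. Qed.

Lemma hratio0r (R : realType) (a : R) : hratio a 0 = 0.
Proof. by rewrite /hratio eqxx orbT. Qed.

Theorem proposition10 (R : realType) (p1 p2 m N T : nat)
  (p1_gt0 : (0 < p1)%N) (p2_gt0 : (0 < p2)%N) (m_gt0 : (0 < m)%N)
  (T_gt0 : (0 < T)%N) (leTN : (T <= N)%N)
  (y : 'I_p1 -> 'I_p2 -> nat -> R) (u : 'I_m -> nat -> R)
  (P Rk : 'M[R]_T) (P_posdef : posdefmx P) (Rk_posdef : posdefmx Rk)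
  (sigma2 : R) (sigma2_gt0 : 0 < sigma2)
  (kappa : R) (kappa_gt0 : 0 < kappa)
  (regr : regressor_assumption N y u P Rk) :
  [/\ forall h j : 'I_p1,
        (forall k l : 'I_p2,
           0 <= T%:R / N%:R * sigma2 - sqnorm_inv P (gLS N T y h k j l)) ->
        exists xi : hyperparam R p1 p2 m,
          lam xi h j = 0 /\
          local_min_on (ell N y u P Rk sigma2) (Xi kappa) xi,
      forall k l : 'I_p2,
        (forall h j : 'I_p1,
           0 <= T%:R / N%:R * sigma2 - sqnorm_inv P (gLS N T y h k j l)) ->
        exists xi : hyperparam R p1 p2 m,
          gam xi k l = 0 /\
          local_min_on (ell N y u P Rk sigma2) (Xi kappa) xi,
      forall h : 'I_p1,
        (forall (k : 'I_p2) (i : 'I_m),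
           0 <= T%:R / N%:R * sigma2 - sqnorm_inv Rk (fLS N T y u h k i)) ->
        exists xi : hyperparam R p1 p2 m,
          ppi xi h = 0 /\
          local_min_on (ell N y u P Rk sigma2) (Xi kappa) xi &
      forall (k : 'I_p2) (i : 'I_m),
        (forall h : 'I_p1,
           0 <= T%:R / N%:R * sigma2 - sqnorm_inv Rk (fLS N T y u h k i)) ->
        exists xi : hyperparam R p1 p2 m,
          omg xi k i = 0 /\
          local_min_on (ell N y u P Rk sigma2) (Xi kappa) xi].
Proof.
have N_gt0 := leq_trans T_gt0 leTN.
have [K ellE] := ell_separable kappa p1_gt0 p2_gt0 m_gt0 T_gt0 N_gt0 sigma2_gt0 regr.
have [xi xiXi xi_min] :=
  separated_ell_argmin N y u P Rk sigma2_gt0 kappa_gt0.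
have local_min xi' : Xi kappa xi' ->
    separated_ell N y u P Rk sigma2 xi' <= separated_ell N y u P Rk sigma2 xi ->
    local_min_on (ell N y u P Rk sigma2) (Xi kappa) xi'.
  move=> xiXi' xi'_le; split => //; rewrite near_withinE.
  apply: nearW => z zXi; rewrite !ellE // lerD2l.
  exact: le_trans xi'_le (xi_min _ zXi).
case: (xiXi) => lamP gamP ppiP omgP; split.
- move=> h j thr; exists (zero_coord xi.1.1.1 (mxtens_index (h, j)), xi.1.1.2, xi.1.2, xi.2).
  split; first by rewrite /lam zero_coordE eqxx.
  apply: local_min.
    by split => // h' j'; apply: zero_coord_bounds; exact: lamP.
  apply: (separated_ell_shrink _ _ xiXi) => // [h' k' j' l'|]; last by left.
  rewrite {1 3}/lam zero_coordE (can_eq (@mxtens_indexK p1 p1)).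
  case: eqP => [[-> ->]|_]; last by left.
  by right; rewrite hratio0l.
- move=> k l thr; exists (xi.1.1.1, zero_coord xi.1.1.2 (mxtens_index (k, l)), xi.1.2, xi.2).
  split; first by rewrite /gam zero_coordE eqxx.
  apply: local_min.
    by split => // k' l'; apply: zero_coord_bounds; exact: gamP.
  apply: (separated_ell_shrink _ _ xiXi) => // [h' k' j' l'|]; last by left.
  rewrite {1 3}/gam zero_coordE (can_eq (@mxtens_indexK p2 p2)).
  case: eqP => [[-> ->]|_]; last by left.
  by right; rewrite hratio0r.
- move=> h thr; exists (xi.1.1.1, xi.1.1.2, zero_coord xi.1.2 h, xi.2).
  split; first by rewrite /ppi zero_coordE eqxx.
  apply: local_min.
    by split => // h'; apply: zero_coord_bounds; exact: ppiP.
  apply: (separated_ell_shrink _ _ xiXi) => // [|h' k' i']; first by left.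
  rewrite {1 3}/ppi zero_coordE; case: eqP => [->|_]; last by left.
  by right; rewrite hratio0l.
move=> k i thr; exists (xi.1.1.1, xi.1.1.2, xi.1.2, zero_coord xi.2 (mxtens_index (k, i))).
split; first by rewrite /omg zero_coordE eqxx.
apply: local_min.
  by split => // k' i'; apply: zero_coord_bounds; exact: omgP.
apply: (separated_ell_shrink _ _ xiXi) => // [|h' k' i']; first by left.
rewrite {1 3}/omg zero_coordE (can_eq (@mxtens_indexK p2 m)).
case: eqP => [[-> ->]|_]; last by left.
by right; rewrite hratio0r.
Qed.
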